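(* Consider the PDDY algorithm with constant stepsizes $\gamma_k\equiv\gamma\in(0,2/L_F)$ and with $\eta\geq\|K\|^2$. Then $x^k$ and $x_R^k$ both converge to some solution $x^\star$ of the primal problem $\min_{x\in\mathcal{X}}F(x)+R(x)+H(Kx)$, and $u^k$ converges to some solution $u^\star$ of the dual problem $\min_{u\in\mathcal{U}}(F+R)^*(-K^*u)+H^*(u)$.
   Context: $\mathcal{X}$ and $\mathcal{U}$ are finite-dimensional real Hilbert spaces, $K:\mathcal{X}\to\mathcal{U}$ is a linear operator with adjoint $K^*$ and operator norm $\|K\|$. $R:\mathcal{X}\to\mathbb{R}\cup\{+\infty\}$ and $H:\mathcal{U}\to\mathbb{R}\cup\{+\infty\}$ are proper, closed, convex functions, and $F:\mathcal{X}\to\mathbb{R}$ is convex and $L_F$-smooth (differentiable with $L_F$-Lipschitz gradient) for some $L_F>0$. For a function $G$, $G^*$ is its convex conjugate and $\mathrm{prox}_G(z)=\arg\min_{z'}\{G(z')+\frac12\|z-z'\|^2\}$. Standing assumption: there exists $x^\star\in\mathcal{X}$ such that $0\in\nabla F(x^\star)+\partial R(x^\star)+K^*\partial H(Kx^\star)$. PDDY algorithm: given positive stepsizes $(\gamma_k)_{k\in\mathbb{N}}$, $\eta>0$ with $\eta\geq\|K\|^2$, $x_R^0\in\mathcal{X}$, $u^0\in\mathcal{U}$, set $p^0=K^*u^0$ and for $k=0,1,\ldots$ iterate $$u^{k+1}=\mathrm{prox}_{H^*/(\gamma_k\eta)}\big(u^k+\tfrac{1}{\gamma_k\eta}Kx_R^k\big),\qquad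 p^{k+1}=K^*u^{k+1},\qquad x^{k+1}=x_R^k-\gamma_k(p^{k+1}-p^k),$$ $$x_R^{k+1}=\mathrm{prox}_{\gamma_{k+1}R}\big(x^{k+1}-\gamma_{k+1}\nabla F(x^{k+1})-\gamma_{k+1}p^{k+1}\big).$$ *)

(* Defs.v *)
From HB Require Import structures.
From mathcomp Require Import all_boot all_order all_algebra.
From mathcomp Require Import all_classical all_reals all_analysis.

Set Implicit Arguments.
Unset Strict Implicit.
Unset Printing Implicit Defensive.

Import Order.TTheory GRing.Theory Num.Theory.
Import numFieldNormedType.Exports.

Local Open Scope classical_set_scope.
Local Open Scope ring_scope.

HB.mixin Record isFinHilbert (R : realType) V & NormedModule R V
    & Vector R V := {
  dotv : {dot V for idfun} ;
  normv_dotv : forall x : V, `|x| = Num.sqrt (dotv x x)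
}.

(* The norm, hence the topology, is the one induced by the inner product;
   completeness is automatic in finite dimension. *)
#[short(type="finHilbertType")]
HB.structure Definition FinHilbert (R : realType) :=
  {V of NormedModule R V & Vector R V & isFinHilbert R V}.

Notation "''[' x , y ]" := (dotv x%R y%R) : ring_scope.

Section operators.
Context {R : realType} {X U : finHilbertType R}.

Definition opnorm (K : X -> U) : R :=
  sup [set `|K x| | x in [set x : X | `|x| <= 1]].

Definition is_adjoint (K : X -> U) (Kadj : U -> X) : Prop :=
  forall x u, '[K x, u] = '[x, Kadj u].

End operators.

Section convex_analysis.
Context {R : realType} {X : finHilbertType R}.
Implicit Types (f : X -> \bar R) (F : X -> R) (x z p g : X).

Definition proper_fun f : Prop :=
  (forall x, f x != -oo%E) /\ exists x, f x != +oo%E.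

Definition closed_fun f : Prop :=
  closed [set q : X * R | (f q.1 <= q.2%:E)%E].

(* Only meant for functions that never take the value -oo. At the endpoints
   the convention 0 * +oo = 0 makes the inequality trivial. *)
Definition convex_fun f : Prop :=
  forall (t : R) x y, 0 <= t <= 1 ->
    (f (t *: x + (1 - t) *: y)%R <= t%:E * f x + (1 - t)%:E * f y)%E.

Definition is_gradient F x g : Prop :=
  differentiable F x /\ forall v, 'd F x v = '[g, v].

Definition is_smooth (L : R) F (gradF : X -> X) : Prop :=
  (forall x, is_gradient F x (gradF x)) /\ L.-lipschitz gradF.

Definition subdifferential f x : set X :=
  [set g | forall y, (f x + ('[g, y - x])%:E <= f y)%E].

Definition conjugate f : X -> \bar R :=
  fun g => ereal_sup [set (('[g, x])%:E - f x)%E | x in [set: X]].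

Definition argmin f : set X := [set x | forall y, (f x <= f y)%E].

(* For proper closed convex f the minimizer exists and is unique, so that
   is_prox f z p reads p = prox_f(z). *)
Definition is_prox f z p : Prop :=
  argmin (fun z' => (f z' + (2^-1 * `|z - z'| ^+ 2)%:E)%E) p.

End convex_analysis.

Section PDDY.
Context {R : realType} {X U : finHilbertType R}.

(* The term x 0 is left unconstrained: the iteration only produces the
   x k with k >= 1. *)
Definition PDDY (gradF : X -> X) (Reg : X -> \bar R) (H : U -> \bar R)
    (K : X -> U) (Kadj : U -> X) (gamma : nat -> R) (eta : R)
    (x xR p : nat -> X) (u : nat -> U) : Prop :=
  p 0%N = Kadj (u 0%N) /\
  forall k : nat,
  [/\ is_prox (fun v => ((gamma k * eta)^-1%:E * conjugate H v)%E)
        (u k + (gamma k * eta)^-1 *: K (xR k)) (u k.+1),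
      p k.+1 = Kadj (u k.+1),
      x k.+1 = xR k - gamma k *: (p k.+1 - p k) &
      is_prox (fun z => ((gamma k.+1)%:E * Reg z)%E)
        (x k.+1 - gamma k.+1 *: gradF (x k.+1) - gamma k.+1 *: p k.+1)
        (xR k.+1)].

Definition primal_solution (F : X -> R) (Reg : X -> \bar R) (H : U -> \bar R)
    (K : X -> U) : set X :=
  argmin (fun x => ((F x)%:E + Reg x + H (K x))%E).

Definition dual_solution (F : X -> R) (Reg : X -> \bar R) (H : U -> \bar R)
    (Kadj : U -> X) : set U :=
  argmin (fun u => (conjugate (fun x => (F x)%:E + Reg x) (- Kadj u)%R
                    + conjugate H u)%E).

End PDDY.

(* Main.v *)
Require Import Defs.
From HB Require Import structures.
From mathcomp Require Import all_boot all_order all_algebra.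
From mathcomp Require Import all_classical all_reals all_analysis.
From mathcomp Require Import ring lra.

Set Implicit Arguments.
Unset Strict Implicit.
Unset Printing Implicit Defensive.

Import Order.TTheory GRing.Theory Num.Theory.
Import numFieldNormedType.Exports.

Local Open Scope classical_set_scope.
Local Open Scope ring_scope.

(** The idea is to follow the point [q^k = xR^k + gamma K* u^k] (called
    [driver]) and to measure the dual variable in the semi-definite metric
    [M = eta - K K*]. In these terms one iteration consists of two inclusions,
[[
      u^{k+1} is in dH (K x^{k+1} + gamma M (u^k - u^{k+1})),
      (x^{k+1} - xR^{k+1}) / gamma - grad F (x^{k+1}) - K* u^{k+1}
        is in dReg (xR^{k+1}),
]]
    together with [q^{k+1} - q^k = xR^{k+1} - x^{k+1}]. Monotonicity of both
    subdifferentials against a solution [(xs, us)], and the cocoercivity of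
    [grad F], make
[[
      V_k = |q^k - (xs + gamma K* us)|^2 + gamma^2 <M (u^k - us), u^k - us>
]]
    decrease by at least
    [(1 - gamma LF / 2) |xR^{k+1} - x^{k+1}|^2
     + gamma^2 <M (u^k - u^{k+1}), u^k - u^{k+1}>] ([lyapunov_decrease]). The
    bound [gamma < 2 / LF] is exactly what makes the first coefficient
    positive, so [xR^k - x^k] and [M (u^k - u^{k+1})] tend to [0]: the two
    inclusions become the optimality conditions in the limit, and by closedness
    of the graphs a cluster point is a solution ([kkt_cluster]). The
    function [V_k] built on this cluster point tends to [0] along a
    subsequence, hence altogether, which forces convergence ([iterates_cvg]).

    Two points need care. If [eta = |K|^2] the metric [M] is degenerate and
    [V_k] does not control [u^k]. However, [u^{k+1}] is the image of
    [M u^k / eta + K q^k / (gamma eta)] under a nonexpansive proximal map, so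
    that [|u^{k+1} - us|] is at most a constant times the square root of [V_k]
    ([dual_distance_le]). Next, the dual step only provides a subgradient of
    [H*]; it is turned into one of [H] by Moreau's decomposition
    ([prox_conjugate_subdifferential]), for which it is enough to know that
    proximal points exist. With subgradients of [H] itself in hand, both primal
    and dual optimality are immediate ([kkt_primal_solution],
    [kkt_dual_solution]). *)

(** * Inner product and orthonormal families *)

Section inner_product.
Context {R : realType} {X : finHilbertType R}.
Implicit Types (x y z : X) (a : R).

Lemma dotC x y : '[x, y] = '[y, x].
Proof. by rewrite hermC /= expr0 mul1r. Qed.

Lemma dotDl x y z : '[x + y, z] = '[x, z] + '[y, z].
Proof. by rewrite linearDl. Qed.

Lemma dotDr x y z : '[x, y + z] = '[x, y] + '[x, z].
Proof. by rewrite linearDr. Qed.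

Lemma dotNl x y : '[- x, y] = - '[x, y].
Proof. by rewrite linearNl. Qed.

Lemma dotNr x y : '[x, - y] = - '[x, y].
Proof. by rewrite linearNr. Qed.

Lemma dotZl a x y : '[a *: x, y] = a * '[x, y].
Proof. by rewrite linearZl_LR. Qed.

Lemma dotZr a x y : '[x, a *: y] = a * '[x, y].
Proof. by rewrite linearZr_LR. Qed.

Lemma dot0l x : '[0, x] = 0.
Proof. by rewrite linear0l. Qed.

Lemma dot0r x : '[x, 0] = 0.
Proof. by rewrite linear0r. Qed.

Lemma dot_suml I (r : seq I) (s : I -> X) y :
  '[\sum_(i <- r) s i, y] = \sum_(i <- r) '[s i, y].
Proof.
by elim: r => [|i r IH]; rewrite ?big_nil ?dot0l// !big_cons dotDl IH.
Qed.

Definition dotE := (dotDl, dotDr, dotNl, dotNr, dotZl, dotZr, dot0l, dot0r).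

Lemma dot_ge0 x : 0 <= '[x, x].
Proof.
have [->|x0] := eqVneq x 0; first by rewrite dot0l.
exact/ltW/neq0_dnorm_gt0.
Qed.

Lemma sqr_norm x : `|x| ^+ 2 = '[x, x].
Proof. by rewrite normv_dotv sqr_sqrtr// dot_ge0. Qed.

(** At the vector [|y| x - |x| y] the positivity of the square norm is the
    Cauchy-Schwarz inequality times [2 |x| |y|]. *)
Lemma cauchy_schwarz x y : '[x, y] <= `|x| * `|y|.
Proof.
have [->|x0] := eqVneq x 0; first by rewrite dot0l normr0 mul0r.
have [->|y0] := eqVneq y 0; first by rewrite dot0r normr0 mulr0.
have xy_gt0 : 0 < `|x| * `|y| by rewrite mulr_gt0 ?normr_gt0.
have := dot_ge0 (`|y| *: x - `|x| *: y).
rewrite !dotE -!sqr_norm (dotC y x) => h.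
rewrite -(ler_pM2l xy_gt0); nra.
Qed.

Lemma norm_sqrD x y : `|x + y| ^+ 2 = `|x| ^+ 2 + 2 * '[x, y] + `|y| ^+ 2.
Proof. by rewrite !sqr_norm !dotE (dotC y x); ring. Qed.

Lemma cvg_dot (s t : nat -> X) x y :
  s @ \oo --> x -> t @ \oo --> y -> (fun n => '[s n, t n]) @ \oo --> '[x, y].
Proof.
move=> sx ty.
(* By polarization the inner product is continuous because the norm is. *)
have polar (u v : X) : '[u, v] = 4^-1 * (`|u + v| ^+ 2 - `|u - v| ^+ 2).
  by rewrite !sqr_norm !dotE (dotC v u); lra.
rewrite polar; under eq_fun do rewrite polar.
apply: cvgMl_tmp; apply: cvgB; rewrite expr2; under eq_fun do rewrite expr2.
  by apply: cvgM; apply: cvg_norm; exact: cvgD.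
by apply: cvgM; apply: cvg_norm; exact: cvgB.
Qed.

(** One Gram-Schmidt step per vector: only the idempotence of the
    reconstruction map [v |-> \sum_e <v, e> e] on the family is recorded,
    which is all that is left of orthonormality. *)
Lemma gram_schmidt (s : seq X) : exists t : seq X,
  (forall v, v \in t -> v = \sum_(e <- t) '[v, e] *: e) /\
  (forall v, v \in s -> v = \sum_(e <- t) '[v, e] *: e).
Proof.
pose P t v := \sum_(e <- t) '[v, e] *: e : X.
elim: s => [|v s [t [tP sP]]]; first by exists [::].
have Psym y z : '[P t y, z] = '[y, P t z].
  rewrite /P; elim: t {tP sP} => [|e t IH]; first by rewrite !big_nil !dotE.
  by rewrite !big_cons !dotE IH (dotC e z) [in RHS]mulrC.
pose w := v - P t v.
have w_orth e : e \in t -> '[w, e] = 0.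
  by move=> et; rewrite /w !dotE Psym /P -(tP _ et) subrr.
have vE : P t v + w = v by rewrite /w addrC subrK.
have [w0|w0] := eqVneq w 0.
  exists t; split=> // v'; rewrite inE => /predU1P[->|/sP//].
  by rewrite -/(P t v) -[LHS]vE w0 addr0.
pose e := `|w|^-1 *: w.
have nw : `|w| != 0 by rewrite normr_eq0.
have e_orth f : f \in t -> '[f, e] = 0.
  by move=> ft; rewrite /e dotZr dotC w_orth// mulr0.
have Pe : P t e = 0.
  rewrite /P big_seq big1// => f ft.
  by rewrite dotC e_orth// scale0r.
have PtP f : '[P t f, e] = 0.
  by rewrite Psym Pe dot0r.
have ee : '[e, e] = 1.
  by rewrite /e dotZl dotZr -sqr_norm; field.
exists (e :: t); split=> f; rewrite inE => /predU1P[->|ft]; rewrite big_cons.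
- by rewrite ee scale1r -/(P t e) Pe addr0.
- by rewrite e_orth// scale0r add0r; exact: tP.
- rewrite -/(P t v) -[v in '[v, e]]vE dotDl PtP add0r.
  rewrite -[LHS]vE addrC; congr (_ + _).
  have -> : w = `|w| *: e by rewrite /e scalerA divff// scale1r.
  by rewrite dotZl ee mulr1.
- rewrite -/(P t f); have fE : f = P t f by exact: sP.
  by rewrite -fE fE PtP scale0r add0r -fE.
Qed.

End inner_product.

(** * Limits of sequences *)

Section limits.

Lemma cvg_increasing_seq (f : nat -> nat) :
  increasing_seq f -> f @ \oo --> \oo.
Proof.
move=> fi P [N _ NP]; exists N => // n /= Nn; apply: NP => /=.
apply: (leq_trans Nn); elim: n {Nn} => // n IH.
apply: (leq_ltn_trans IH).
by have := leqW_mono fi n n.+1; rewrite /= ltnS leqnn.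
Qed.

Context {R : realType}.

Lemma cvg_dist_le (X : normedModType R) (s : nat -> X) l (e : nat -> R) :
  (forall n, `|s n - l| <= e n) -> e @ \oo --> 0 -> s @ \oo --> l.
Proof.
move=> se e0; apply: (cvg_sub0 _ (cvg_cst l)); apply: norm_cvg0.
apply: (squeeze_cvgr _ (cvg_cst 0) e0).
by apply: nearW => n; rewrite normr_ge0 se.
Qed.

Lemma cvg_bounded_linear (X U : normedModType R) (A : {linear X -> U}) (C : R)
    (s : nat -> X) l :
  (forall v, `|A v| <= C * `|v|) -> s @ \oo --> l ->
  (fun n => A (s n)) @ \oo --> A l.
Proof.
move=> AC sl; apply: (@cvg_dist_le _ _ _ (fun n => C * `|s n - l|)) => [n|].
  by rewrite -linearB.
rewrite -(mulr0 C); apply: cvgMl_tmp; rewrite -[X in _ --> X](@normr0 _ X).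
by apply: cvg_norm; rewrite -(subrr l); apply: cvgB => //; exact: cvg_cst.
Qed.

Lemma decrement_cvg0 (V : nat -> R) : (forall k, 0 <= V k) ->
  (forall k, V k.+1 <= V k) -> (fun k => V k - V k.+1) @ \oo --> 0.
Proof.
move=> V0 Vd.
have : cvgn V.
  apply: nonincreasing_is_cvgn; first exact/nonincreasing_seqP.
  by exists 0 => _ [k _ <-].
move=> /cvg_ex[l Vl]; rewrite -(subrr l); apply: cvgB => //.
by rewrite cvg_shiftS.
Qed.

Lemma nonincreasing_subseq_cvg0 (V : nat -> R) (f : nat -> nat) :
  (forall k, 0 <= V k) -> (forall k, V k.+1 <= V k) -> increasing_seq f ->
  (V \o f) @ \oo --> 0 -> V @ \oo --> 0.
Proof.
move=> V0 Vd fi Vf.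
have : cvgn V.
  apply: nonincreasing_is_cvgn; first exact/nonincreasing_seqP.
  by exists 0 => _ [k _ <-].
move=> /cvg_ex[l Vl]; suff -> : 0 = l by [].
apply: cvg_unique Vf (cvg_comp _ _ (cvg_increasing_seq fi) Vl) => //.
Qed.

Lemma sqrtr_cvg0 (w : nat -> R) :
  w @ \oo --> 0 -> (fun n => Num.sqrt (w n)) @ \oo --> 0.
Proof.
move=> w0; rewrite -[X in _ --> X](@sqrtr0 R); apply: cvg_comp w0 _.
exact: sqrt_continuous.
Qed.

Lemma norm_le_sqrt (X : normedModType R) (v : X) (a : R) :
  `|v| ^+ 2 <= a -> `|v| <= Num.sqrt a.
Proof. by move=> va; rewrite -[leLHS]ger0_norm// -sqrtr_sqr ler_wsqrtr. Qed.

End limits.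

(** * Compactness and bounded operators in finite dimension *)

Section finite_dimension.
Context {R : realType} {X : finHilbertType R}.

Lemma orthonormal_expansion :
  exists t : seq X, forall v : X, v = \sum_(e <- t) '[v, e] *: e.
Proof.
have [t [_ tP]] := gram_schmidt (vbasis (fullv : {vspace X})).
exists t => v.
rewrite [in RHS](coord_vbasis (memvf v)).
under [RHS]eq_bigr do rewrite dot_suml scaler_suml.
rewrite exchange_big/= [LHS](coord_vbasis (memvf v)).
apply: eq_bigr => i _.
under eq_bigr do rewrite dotZl -scalerA.
by rewrite -scaler_sumr -tP// mem_nth// size_tuple.
Qed.

(** Coordinatewise Bolzano-Weierstrass in an orthonormal family. *)
Lemma bounded_cvg_subseq (s : nat -> X) (M : R) :
  (forall n, `|s n| <= M) ->
  exists2 f : nat -> nat, increasing_seq f & cvgn (s \o f).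
Proof.
move=> sM; have [t tP] := orthonormal_expansion.
have [f fi ft] : exists2 f : nat -> nat, increasing_seq f &
    forall e, e \in t -> cvgn (fun n => '[s (f n), e]).
  elim: t {tP} => [|e t [f fi ft]]; first by exists id.
  have [g gi ge] : exists2 g : nat -> nat, increasing_seq g &
      cvgn ((fun n => '[s (f n), e]) \o g).
    apply: bolzano_weierstrass; exists (M * `|e|); split; first exact: num_real.
    move=> c Mc n _ /=; apply/(le_trans _ (ltW Mc)).
    have := cauchy_schwarz (s (f n)) e.
    have := cauchy_schwarz (- s (f n)) e.
    rewrite dotNl normrN ler_norml => h1 h2.
    have := ler_wpM2r (normr_ge0 e) (sM (f n)); lra.
  exists (f \o g); first by move=> m n; exact: etrans (fi _ _) (gi _ _).
  move=> e'; rewrite inE => /predU1P[->//|e't].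
  apply/cvg_ex; have /cvg_ex[l fl] := ft _ e't.
  by exists l; apply: (cvg_comp _ _ (cvg_increasing_seq gi) fl).
exists f => //; apply/cvg_ex.
exists (\sum_(e <- t) lim ((fun n => '[s (f n), e]) @ \oo) *: e).
rewrite (_ : s \o f = fun n => \sum_(e <- t) '[s (f n), e] *: e); last first.
  by apply/funext => n /=; exact: tP.
rewrite [X in _ --> X]big_seq; under eq_fun do rewrite big_seq.
apply: cvg_big => [|e et]; first exact: add_continuous.
by apply: cvgZr_tmp; exact: ft.
Qed.

End finite_dimension.

Section adjoint.
Context {R : realType} {X U : finHilbertType R}.
Context (K : {linear X -> U}) (Kadj : {linear U -> X}).
Hypothesis adjK : is_adjoint K Kadj.

(** The supremum defining the operator norm takes the value [0] on an unbounded
    set, so boundedness has to be shown first: the coordinates of [K z] are the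
    inner products of [z] with the fixed vectors [Kadj e]. *)
Lemma opnormP (x : X) : `|K x| <= opnorm K * `|x|.
Proof.
have hs : has_sup [set `|K z| | z in [set z : X | `|z| <= 1]].
  split; first by exists `|K 0|, 0 => //=; rewrite normr0.
  have [t tP] := @orthonormal_expansion R U.
  exists (\sum_(e <- t) `|Kadj e| * `|e|) => _ [z /= z1 <-].
  rewrite (tP (K z)); apply: (le_trans (ler_norm_sum _ _ _)).
  apply: ler_sum => e _; rewrite normrZ ler_wpM2r//.
  have := cauchy_schwarz z (Kadj e); have := cauchy_schwarz (- z) (Kadj e).
  rewrite dotNl normrN -adjK => h1 h2.
  have := ler_wpM2r (normr_ge0 (Kadj e)) z1.
  rewrite ler_norml; lra.
have [->|x0] := eqVneq x 0; first by rewrite linear0 !normr0 mulr0.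
have nx : 0 < `|x| by rewrite normr_gt0.
have : `|K (`|x|^-1 *: x)| <= opnorm K.
  apply: ub_le_sup; first by case: hs.
  by exists (`|x|^-1 *: x) => //=; rewrite normrZ normfV normr_id mulVf ?gt_eqF.
by rewrite linearZ normrZ normfV normr_id ler_pdivrMl// mulrC.
Qed.

Variable eta : R.
Hypothesis K_eta : opnorm K ^+ 2 <= eta.

Lemma opnorm_ge0 : 0 <= opnorm K.
Proof.
have [U0|] := pselect (forall x, K x = 0).
  rewrite /opnorm (_ : [set _ | _ in _] = [set 0]) ?sup1//.
  apply/seteqP; split=> [_ [z _ <-]|_ ->]; first by rewrite U0 normr0.
  by exists 0; rewrite /= ?normr0// U0 normr0.
move=> /existsNP[x Kx]; have := opnormP x; apply: contraTT.
rewrite -!ltNge => K0; apply: (@le_lt_trans _ _ 0).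
  by rewrite mulr_le0_ge0// ltW.
by rewrite normr_gt0; apply/eqP.
Qed.

Lemma sqr_norm_le (x : X) : '[K x, K x] <= eta * '[x, x].
Proof.
rewrite -!sqr_norm; apply: (@le_trans _ _ ((opnorm K * `|x|) ^+ 2)).
  by rewrite ler_pXn2r ?nnegrE ?mulr_ge0 ?opnorm_ge0// opnormP.
by rewrite exprMn ler_wpM2r// sqr_ge0.
Qed.

(** A bounded operator and its adjoint have the same bound:
    [|K* v|^2 = <K K* v, v> <= |K K* v| |v|]. *)
Lemma sqr_norm_adj_le (v : U) : '[Kadj v, Kadj v] <= eta * '[v, v].
Proof.
have [v0|v0] := eqVneq '[Kadj v, Kadj v] 0.
  by rewrite v0 mulr_ge0 ?dot_ge0// (le_trans _ K_eta)// sqr_ge0.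
have {v0}n0 : 0 < '[Kadj v, Kadj v] by rewrite lt_neqAle eq_sym v0 dot_ge0.
have cs := cauchy_schwarz (K (Kadj v)) v; rewrite adjK in cs.
have := sqr_norm_le (Kadj v).
rewrite -!sqr_norm in n0 cs *; move: n0 cs => n0 cs kb.
rewrite -(ler_pM2r n0).
apply: (@le_trans _ _ ((`|K (Kadj v)| * `|v|) ^+ 2)).
  by rewrite -expr2 ler_pXn2r ?nnegrE ?sqr_ge0 ?mulr_ge0.
by rewrite exprMn [leRHS]mulrAC ler_wpM2r ?sqr_ge0.
Qed.

End adjoint.

(** * Smooth convex functions *)

Section smooth_convex.
Context {R : realType} {X : finHilbertType R}.
Implicit Types (F : X -> R) (x y z g v : X).

Lemma is_derive_line F x v (t : R) : differentiable F (x + t *: v) ->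
  is_derive t 1 (fun s : R => F (x + s *: v)) ('d F (x + t *: v) v).
Proof.
move=> dF; have Fv := diff_derivable dF (v := v).
have E : (fun h : R =>
         h^-1 *: (F (x + (h *: (1 : R) + t) *: v) - F (x + t *: v))) =
    (fun h : R => h^-1 *: (F (h *: v + (x + t *: v)) - F (x + t *: v))).
  by apply/funext => h; rewrite scalerDl scaler1 addrCA.
apply: DeriveDef.
  by rewrite /derivable /= E; exact: Fv.
by rewrite /derive /= E -/('D_v F (x + t *: v)) deriveE.
Qed.

(** The difference quotients of a convex function along a segment are bounded
    by its increment over the segment. *)
Lemma convex_gradient_le F x g y :
  convex_function setT F -> is_gradient F x g -> F x + '[g, y - x] <= F y.
Proof.
move=> cF [dF gE]; set v := y - x.
have := is_derive_line (F := F) (x := x) (v := v) (t := 0).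
rewrite scale0r addr0 gE => /(_ dF)[].
rewrite /derivable /derive/= => dv dE.
rewrite -lerBrDl -dE; have /cvg_ex[l ql] := dv.
rewrite (cvg_lim _ ql)//; have qr := cvg_dnbhs_at_right ql.
rewrite -(cvg_lim _ qr)//; apply: limr_le; first by apply/cvg_ex; exists l.
near=> h.
have h0 : 0 < h by near: h; exact: nbhs_right_gt.
have h1 : h <= 1 by near: h; apply: nbhs_right_le.
rewrite scaler1 addr0 scale0r addr0 /GRing.scale/=.
rewrite ler_pdivrMl// lerBlDr.
have : F (h *: y + (1 - h) *: x) <= h * F y + (1 - h) * F x.
  exact: (cF (Itv01 (ltW h0) h1) y x (in_setT _) (in_setT _)).
have -> : h *: y + (1 - h) *: x = x + h *: v.
  by rewrite /v scalerBr scalerBl scale1r addrCA addrC.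
by lra.
Unshelve. all: by end_near. Qed.

(** Along the segment, [F] minus its quadratic upper model has derivative
    [<grad F (x + t v) - grad F x, v> - L t |v|^2], which is nonpositive by the
    Lipschitz bound. *)
Lemma descent (L : R) F (gradF : X -> X) x y : 0 < L ->
  is_smooth L F gradF ->
  F y <= F x + '[gradF x, y - x] + L / 2 * `|y - x| ^+ 2.
Proof.
move=> L0 [gF lipF]; set v := y - x.
pose c := '[gradF x, v]; pose d := L / 2 * `|v| ^+ 2.
pose phi t := F (x + t *: v) - (c * t + d * t ^+ 2).
have dphi (t : R) :
    is_derive t 1 phi ('[gradF (x + t *: v), v] - (c + d * (2 * t))).
  have := is_derive_line (gF (x + t *: v)).1 (v := v) (t := t).
  rewrite (gF _).2 => dF.
  apply: is_deriveB => //; apply: is_derive_eq.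
  by rewrite /GRing.scale/=; ring.
have : phi 1 <= phi 0.
  apply: (@ler0_derive1_le_cc R phi 0 1) => //.
  - move=> t; rewrite in_itv/= => /andP[t0 _].
    rewrite derive1E; have [_ ->] := dphi t.
    have := cauchy_schwarz (gradF (x + t *: v) - gradF x) v.
    have /(_ (x + t *: v, x)) /= := lipF; rewrite dotDl dotNl.
    rewrite addrAC subrr add0r normrZ gtr0_norm// => /(_ (conj I I)) lip cs.
    have := le_trans cs (ler_wpM2r (normr_ge0 v) lip); rewrite /c /d; lra.
  - by apply: derivable_within_continuous => t _; case: (dphi t).
  - by rewrite in_itv/= ler01 lexx.
  - by rewrite in_itv/= lexx ler01.
have xv : x + v = y by rewrite /v addrC subrK.
by rewrite /phi scale1r scale0r addr0 xv -/c -/d; lra.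
Qed.

(** Baillon-Haddad: the descent step [x - L^-1 (grad F x - grad F y)] cannot go
    below the minimum, at [y], of the tilted function [F - <grad F y, .>]. *)
Lemma gradient_cocoercive (L : R) F (gradF : X -> X) x y : 0 < L ->
  convex_function setT F -> is_smooth L F gradF ->
  `|gradF x - gradF y| ^+ 2 <= L * '[gradF x - gradF y, x - y].
Proof.
move=> L0 cF sF; have Ln0 : L != 0 by rewrite gt_eqF.
have half a b : (2 * L)^-1 * `|gradF a - gradF b| ^+ 2 <=
    F a - F b - '[gradF b, a - b].
  set g := gradF a - gradF b; set z := a - L^-1 *: g.
  have h1 := convex_gradient_le z cF (sF.1 b).
  have h2 := descent a z L0 sF.
  have gE : '[g, g] = '[gradF a, g] - '[gradF b, g] by rewrite -dotNl -dotDl.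
  have za : z - a = - (L^-1 *: g) by rewrite /z addrAC subrr add0r.
  have zb : z - b = (a - b) - L^-1 *: g by rewrite /z addrAC.
  rewrite za sqr_norm (dotNr (gradF a)) dotNl dotNr opprK !dotZl !dotZr in h2.
  rewrite zb dotDr dotNr dotZr in h1.
  rewrite sqr_norm.
  have e1 : L / 2 * (L^-1 * (L^-1 * '[g, g])) = (2 * L)^-1 * '[g, g] by field.
  have e2 : L^-1 * '[g, g] = 2 * ((2 * L)^-1 * '[g, g]) by field.
  rewrite e1 in h2; rewrite gE mulrBr in e2.
  rewrite -gE in e2; lra.
have := half x y; have := half y x.
rewrite -[gradF y - _]opprB normrN => h1 h2.
have e : L * (2 * L)^-1 = 2^-1 by field.
have -> : '[gradF x - gradF y, x - y] =
    - '[gradF x, y - x] - '[gradF y, x - y] by rewrite !dotE; ring.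
rewrite -ler_pdivrMl//.
have -> : L^-1 = 2 * (2 * L)^-1 by field.
lra.
Qed.

End smooth_convex.

(** * Subdifferentials *)

Section subdifferentials.
Context {R : realType} {X : finHilbertType R}.
Implicit Types (f : X -> \bar R) (x y z p g v : X).

(** For a proper function the extended real inequality is only informative on
    the effective domain, to which the base point has to belong; this turns
    subgradients into a statement about real numbers. *)
Lemma proper_subdifferentialP f x g : proper_fun f ->
  subdifferential f x g <->
  f x \is a fin_num /\
  forall v, f v \is a fin_num -> fine (f x) + '[g, v - x] <= fine (f v).
Proof.
move=> [fNy [w wy]]; split=> [sf|[fx sf] v].
  have fx : f x \is a fin_num.
    rewrite fin_numE fNy/=; apply/eqP => fxy.
    by have := sf w; rewrite fxy/= leye_eq (negbTE wy).
  split=> // v fv; have := sf v.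
  by rewrite -(fineK fx) -(fineK fv) -EFinD lee_fin.
have [fv|] := boolP (f v \is a fin_num).
  by rewrite -(fineK fx) -(fineK fv) -EFinD lee_fin sf.
by rewrite fin_numE fNy/= negbK => /eqP ->; rewrite leey.
Qed.

Lemma subdifferential_monotone f x y g h : proper_fun f ->
  subdifferential f x g -> subdifferential f y h -> 0 <= '[g - h, x - y].
Proof.
move=> pf /(proper_subdifferentialP _ _ pf)[fx sx].
move=> /(proper_subdifferentialP _ _ pf)[fy sy].
have := sx _ fy; have := sy _ fx.
rewrite !dotE; lra.
Qed.

Lemma le0_of_le_small (a b : R) :
  (forall t, 0 < t <= 1 -> a <= t * b) -> a <= 0.
Proof.
move=> h; rewrite leNgt; apply/negP => a0.
have b0 : a <= b by have := h 1; rewrite ltr01 lexx mul1r; apply.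
have ab : 0 < a + b + 1 by lra.
(* This choice makes [t * b] smaller than [a] if [0 < a]. *)
have := h (a / (a + b + 1)).
rewrite divr_gt0// ler_pdivrMr// mul1r mulrAC ler_pdivlMr//.
have -> : a <= a + b + 1 by lra.
move=> /(_ isT); nra.
Qed.

(** First order optimality: compare the minimizer [p] with the points
    [t v + (1 - t) p] of a segment and let [t] tend to [0]. *)
Lemma prox_subdifferential f (c : R) z p : proper_fun f -> convex_fun f ->
  0 < c -> is_prox (fun v => (c%:E * f v)%E) z p ->
  subdifferential f p (c^-1 *: (z - p)).
Proof.
move=> pf cf c0 zp; have [fNy [w wy]] := pf.
have fw : f w \is a fin_num by rewrite fin_numE fNy wy.
have fp : f p \is a fin_num.
  rewrite fin_numE fNy/=; apply/eqP => fpy.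
  by have := zp w; rewrite /= fpy -(fineK fw) gt0_muley ?lte_fin// addye.
apply/proper_subdifferentialP => //; split=> // v fv.
rewrite dotZl -(ler_pM2l c0) mulrDr mulrA divff ?gt_eqF// mul1r -subr_le0.
apply: (@le0_of_le_small _ (2^-1 * `|v - p| ^+ 2)) => t /andP[t0 t1].
have t01 : 0 <= t <= 1 by rewrite t1 ltW.
have := cf t v p t01; set y := t *: v + (1 - t) *: p.
rewrite -(fineK fp) -(fineK fv) -!EFinM -EFinD => fy_le.
have fy : f y \is a fin_num.
  by rewrite fin_numE fNy -ltey (le_lt_trans fy_le)// ltry.
move: fy_le; rewrite -(fineK fy) lee_fin => fy_le.
have := zp y; rewrite /= -(fineK fp) -(fineK fy) -!EFinM -!EFinD lee_fin.
have -> : z - y = (z - p) + (- t) *: (v - p).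
  have -> : y = p + t *: (v - p) by rewrite /y scalerBl scale1r scalerBr addrCA.
  by rewrite opprD addrA scaleNr.
rewrite (norm_sqrD (z - p) (- t *: _)) normrZ normrN gtr0_norm// exprMn.
rewrite dotZr => h.
rewrite -(ler_pM2l t0).
have := ler_wpM2l (ltW c0) fy_le; lra.
Qed.

(** The subgradient inequality at [s n], against a fixed [v], places the point
    [(s n, f v - <g n, v - s n>)] in the epigraph of [f], which is closed. *)
Lemma subdifferential_closed f (s g : nat -> X) x h :
  proper_fun f -> closed_fun f -> (forall n, subdifferential f (s n) (g n)) ->
  s @ \oo --> x -> g @ \oo --> h -> subdifferential f x h.
Proof.
move=> pf clf sg sx gh v; have [fNy _] := pf.
have [fv|] := boolP (f v \is a fin_num); last first.
  by rewrite fin_numE fNy/= negbK => /eqP ->; rewrite leey.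
pose e n := fine (f v) - '[g n, v - s n].
have ex : e @ \oo --> fine (f v) - '[h, v - x].
  apply: cvgB; first exact: cvg_cst.
  by apply: cvg_dot => //; apply: cvgB => //; exact: cvg_cst.
have : [set q : X * R | (f q.1 <= q.2%:E)%E] (x, fine (f v) - '[h, v - x]).
  apply: (@closed_cvg _ _ \oo _ (fun n => (s n, e n)) _ clf);
    last exact: cvg_pair sx ex.
  apply: nearW => n /=.
  have /(proper_subdifferentialP _ _ pf)[fs /(_ v fv)] := sg n.
  by rewrite -(fineK fs) lee_fin /e; lra.
move=> /= fx.
have ffx : f x \is a fin_num.
  by rewrite fin_numE fNy -ltey (le_lt_trans fx)// ltry.
by move: fx; rewrite -(fineK ffx) -(fineK fv) -EFinD !lee_fin; lra.
Qed.

End subdifferentials.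

(** * Proximal points and conjugates *)

Section proximal_point.
Context {R : realType} {X : finHilbertType R}.
Implicit Types (f : X -> \bar R) (x y z p g u v w : X).

(** The affine minorant given by a subgradient makes [c f + |z - .|^2 / 2]
    coercive, so a minimizing sequence has a cluster point, and the epigraph
    of [f] being closed this point is a minimizer. *)
Lemma prox_exists f (c : R) z w g : proper_fun f -> closed_fun f -> 0 < c ->
  subdifferential f w g -> exists p, is_prox (fun v => (c%:E * f v)%E) z p.
Proof.
move=> pf clf c0 /(proper_subdifferentialP _ _ pf)[fw sw]; have [fNy _] := pf.
pose phi v := c * fine (f v) + 2^-1 * `|z - v| ^+ 2.
pose E := [set phi v | v in [set v | f v \is a fin_num]].
(* [C] is what remains of the affine minorant of [c f] plus
   [|z - v|^2 / 2] after completing the square in [v]. *)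
pose C := c * fine (f w) + c * '[g, z - w] - 2^-1 * `|c *: g| ^+ 2.
have phi_ge v : f v \is a fin_num -> C + 2^-1 * `|z - v - c *: g| ^+ 2 <= phi v.
  move=> fv; have := ler_wpM2l (ltW c0) (sw v fv).
  rewrite /phi /C (norm_sqrD (z - v) (- (c *: g))) normrN dotNr dotZr.
  rewrite (dotC _ g) !dotE; lra.
have infE : has_inf E.
  split; first by exists (phi w), w.
  exists C => _ [v fv <-]; have := phi_ge v fv.
  have := sqr_ge0 `|z - v - c *: g|; lra.
have /choice[s sP] : forall n : nat, exists v,
    f v \is a fin_num /\ phi v < inf E + n.+1%:R^-1.
  move=> n; have n0 : 0 < n.+1%:R^-1 :> R by rewrite invr_gt0.
  by have [_ [v fv <-] ?] := inf_adherent n0 infE; exists v.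
have [B sB] : exists B : R, forall n, `|s n| <= B.
  exists (1 + 2 * (inf E + 1 - C) + `|z - c *: g|) => n; have [fs ps] := sP n.
  have n1 : n.+1%:R^-1 <= 1 :> R by rewrite invf_le1// ler1n.
  have := phi_ge _ fs; set a := `|z - s n - c *: g| => h.
  have a1 : a <= 1 + a ^+ 2 by have := sqr_ge0 (a - 2^-1); nra.
  have -> : s n = (z - c *: g) - (z - s n - c *: g).
    by rewrite [z - s n - _]addrAC opprB [RHS]addrC subrK.
  have := ler_normB (z - c *: g) (z - s n - c *: g); rewrite -/a.
  move: (n.+1%:R^-1 : R) (phi (s n)) n1 ps h => r ph n1 ps h. lra.
have [h hi /cvg_ex[p shp]] := bounded_cvg_subseq sB.
have fp : (f p <= (c^-1 * (inf E - 2^-1 * `|z - p| ^+ 2))%:E)%E.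
  pose e n := c^-1 * (inf E + (h n).+1%:R^-1 - 2^-1 * `|z - s (h n)| ^+ 2).
  have ep : e @ \oo --> c^-1 * (inf E - 2^-1 * `|z - p| ^+ 2).
    apply: cvgMl_tmp; apply: cvgB.
      rewrite -[X in _ --> X]addr0; apply: cvgD; first exact: cvg_cst.
      exact: (cvg_comp _ _ (cvg_increasing_seq hi) (@cvg_harmonic R)).
    apply: cvgMl_tmp; rewrite expr2; under eq_fun do rewrite expr2.
    by apply: cvgM; apply: cvg_norm; apply: cvgB => //; exact: cvg_cst.
  have : [set q : X * R | (f q.1 <= q.2%:E)%E]
      (p, c^-1 * (inf E - 2^-1 * `|z - p| ^+ 2)) => //.
  apply: (@closed_cvg _ _ \oo _ (fun n => (s (h n), e n)) _ clf);
    last exact: cvg_pair shp ep.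
  apply: nearW => n /=; have [fs] := sP (h n).
  rewrite -(fineK fs) lee_fin /e /phi ler_pdivlMl//.
  move: ((h n).+1%:R^-1 : R) => r; lra.
have ffp : f p \is a fin_num.
  by rewrite fin_numE fNy -ltey (le_lt_trans fp)// ltry.
exists p => v /=.
have [fv|] := boolP (f v \is a fin_num); last first.
  rewrite fin_numE fNy/= negbK => /eqP ->.
  by rewrite gt0_muley ?lte_fin// addye// leey.
rewrite -(fineK ffp) -(fineK fv) -!EFinM -!EFinD lee_fin.
have := ge_inf infE.2 (imageP phi fv).
move: fp; rewrite -(fineK ffp) lee_fin ler_pdivlMl// -/(phi v); lra.
Qed.

Lemma conjugate_ge f x u : ('[u, x]%:E - f x <= conjugate f u)%E.
Proof. by apply: ereal_sup_ubound; exists x. Qed.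

Lemma conjugate_subdifferential f x u : proper_fun f ->
  subdifferential f x u -> conjugate f u = ('[u, x] - fine (f x))%:E.
Proof.
move=> pf sx; have [fx s] := (proper_subdifferentialP _ _ pf).1 sx.
apply/eqP; rewrite eq_le; apply/andP; split; last first.
  by have := conjugate_ge f x u; rewrite -{1}(fineK fx).
apply: ge_ereal_sup => _ [v _ <-].
have [fv|] := boolP (f v \is a fin_num); last first.
  by rewrite fin_numE (pf.1 v)/= negbK => /eqP ->; rewrite addeNy leNye.
have := s v fv; rewrite -{2}(fineK fv) lee_fin !dotE; lra.
Qed.

(** Moreau's decomposition: with [w] the proximal point of [f / c] at [z / c],
    the vector [z - c w] is a subgradient of [f] at [w], hence [w] is one of
    the conjugate at [z - c w], and by strong convexity [z - c w] is the only
    minimizer defining the proximal point of [c f*] at [z]. In this way a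
    proximal step on the conjugate gives back a subgradient of [f] itself,
    and the biconjugate never enters. *)
Lemma prox_conjugate_subdifferential f (c : R) z u : proper_fun f ->
  closed_fun f -> convex_fun f -> (exists x, subdifferential f x !=set0) ->
  0 < c -> is_prox (fun v => (c%:E * conjugate f v)%E) z u ->
  subdifferential f (c^-1 *: (z - u)) u.
Proof.
move=> pf clf cf [x [g sg]] c0 zu.
have ci0 : 0 < c^-1 by rewrite invr_gt0.
have [w zw] := prox_exists (c^-1 *: z) pf clf ci0 sg.
have := prox_subdifferential pf cf ci0 zw; rewrite invrK scalerBr scalerA.
rewrite divff ?gt_eqF// scale1r; set u' := z - c *: w => sw.
have [fw _] := (proper_subdifferentialP _ _ pf).1 sw.
suff uu : u = u'.
  rewrite uu /u' opprB addrC subrK scalerA mulVf ?gt_eqF// scale1r.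
  by rewrite -/u'.
have := zu u'; rewrite /= (conjugate_subdifferential pf sw).
have cu : ((c * ('[u, w] - fine (f w)))%:E <= c%:E * conjugate f u)%E.
  rewrite EFinM lee_pmul2l//.
  by have := conjugate_ge f w u; rewrite -{1}(fineK fw).
move=> h.
have {cu h} := le_trans (leeD2r _ cu) h.
rewrite -EFinM -!EFinD lee_fin.
have -> : z - u = (z - u') + (u' - u) by rewrite addrA subrK.
rewrite (norm_sqrD (z - u') (u' - u)).
have -> : z - u' = c *: w by rewrite /u' opprB addrC subrK.
rewrite dotZl dotDr dotNr (dotC w) (dotC w) => h.
have : `|u' - u| ^+ 2 <= 0 by lra.
rewrite exprn_even_le0//= normr_eq0 subr_eq0 => /eqP ->//.
Qed.

End proximal_point.

(** * Optimality conditions *)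

Section optimality.
Context {R : realType} {X U : finHilbertType R}.
Context (K : {linear X -> U}) (Kadj : {linear U -> X}).
Context (F : X -> R) (gradF : X -> X) (Reg : X -> \bar R) (H : U -> \bar R).
Hypotheses (adjK : is_adjoint K Kadj) (convexF : convex_function setT F).
Hypothesis gradientF : forall x, is_gradient F x (gradF x).
Hypotheses (properReg : proper_fun Reg) (properH : proper_fun H).

(** The inclusion [0 in grad F x + dReg x + K* dH (K x)] with the subgradient of
    [H] that realizes it made explicit. *)
Definition kkt_point (x : X) (u : U) : Prop :=
  subdifferential Reg x (- (gradF x + Kadj u)) /\ subdifferential H (K x) u.

Lemma proper_smooth_add : proper_fun (fun x => (F x)%:E + Reg x)%E.
Proof.
have [RNy [w wy]] := properReg; split.
  by move=> x; case: (Reg x) (RNy x).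
by exists w; case: (Reg w) wy (RNy w).
Qed.

(** The gradient inequality for [F] adds up with the subgradient inequality
    for [Reg], and [grad F x] cancels. *)
Lemma kkt_smooth_add x u : kkt_point x u ->
  subdifferential (fun x => (F x)%:E + Reg x)%E x (- Kadj u).
Proof.
move=> [sR _]; have [Rx s] := (proper_subdifferentialP _ _ properReg).1 sR.
apply/(proper_subdifferentialP _ _ proper_smooth_add); split.
  by rewrite fin_numD Rx.
move=> v; rewrite fin_numD /= => Rv.
have := s v Rv; have := convex_gradient_le v convexF (gradientF x).
rewrite !fineD//= !dotE; lra.
Qed.

Lemma kkt_primal_solution x u : kkt_point x u -> primal_solution F Reg H K x.
Proof.
move=> xu y; have sR := kkt_smooth_add xu; have [_ sH] := xu.
have [Rx _] := (proper_subdifferentialP _ _ proper_smooth_add).1 sR.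
have [Hx _] := (proper_subdifferentialP _ _ properH).1 sH.
have := leeD (sR y) (sH (K y)).
rewrite -linearB (dotC u) adjK dotNl (dotC (Kadj u)).
by rewrite -(fineK Rx) -(fineK Hx) -!EFinD addrACA addNr addr0.
Qed.

(** Both conjugates are attained at the point, so the dual objective equals
    minus the primal one there; everywhere else it is at least as large by
    the Fenchel-Young inequality. *)
Lemma kkt_dual_solution x u : kkt_point x u -> dual_solution F Reg H Kadj u.
Proof.
move=> xu v; have sR := kkt_smooth_add xu; have [_ sH] := xu.
have [Rx _] := (proper_subdifferentialP _ _ proper_smooth_add).1 sR.
have [Hx _] := (proper_subdifferentialP _ _ properH).1 sH.
rewrite (conjugate_subdifferential proper_smooth_add sR).
rewrite (conjugate_subdifferential properH sH).
apply: le_trans (leeD (conjugate_ge _ x _) (conjugate_ge _ (K x) _)).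
rewrite -(fineK Rx) -(fineK Hx) -!EFinB -!EFinD lee_fin/=.
rewrite !dotNl (dotC u) (dotC v) !adjK (dotC x) (dotC x); lra.
Qed.

End optimality.

(** * The iteration and its Lyapunov function *)

Section iteration.
Context {R : realType} {X U : finHilbertType R}.
Context (K : {linear X -> U}) (Kadj : {linear U -> X}).
Context (F : X -> R) (gradF : X -> X) (LF : R).
Context (Reg : X -> \bar R) (H : U -> \bar R).
Context (gamma eta : R) (x xR p : nat -> X) (u : nat -> U).
Hypothesis adjK : is_adjoint K Kadj.
Hypotheses (properReg : proper_fun Reg) (closedReg : closed_fun Reg).
Hypothesis convexReg : convex_fun Reg.
Hypotheses (properH : proper_fun H) (closedH : closed_fun H).
Hypothesis convexH : convex_fun H.
Hypothesis convexF : convex_function setT F.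
Hypotheses (LF_gt0 : 0 < LF) (smoothF : is_smooth LF F gradF).
Hypotheses (gamma_gt0 : 0 < gamma) (gamma_lt : gamma < 2 / LF).
Hypotheses (eta_gt0 : 0 < eta) (eta_ge : opnorm K ^+ 2 <= eta).
Hypothesis iter : PDDY gradF Reg H K Kadj (fun=> gamma) eta x xR p u.

Let kkt := kkt_point K Kadj gradF Reg H.

(** The operator [eta - K K*], nonnegative because [eta] dominates the square
    of the operator norm, and singular if the two agree. *)
Definition metric (v : U) : U := eta *: v - K (Kadj v).

Lemma metricB v w : metric (v - w) = metric v - metric w.
Proof.
by rewrite /metric scalerBr (linearB Kadj) (linearB K)/= !opprD !opprK addrACA.
Qed.

Lemma dot_metric v : '[metric v, v] = eta * '[v, v] - '[Kadj v, Kadj v].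
Proof. by rewrite dotDl dotNl dotZl adjK. Qed.

Lemma metric_sym v w : '[metric v, w] = '[metric w, v].
Proof.
by rewrite !dotDl !dotNl !dotZl !adjK (dotC w v) (dotC (Kadj w)).
Qed.

Lemma metric_ge0 v : 0 <= '[metric v, v].
Proof. by rewrite dot_metric subr_ge0 (sqr_norm_adj_le adjK eta_ge). Qed.

(** With [S := K K*] and [M := eta - S] this is [M^2 <= eta M], that is
    [eta S - S^2 >= 0]. *)
Lemma sqr_norm_metric_le v : `|metric v| ^+ 2 <= eta * '[metric v, v].
Proof.
rewrite sqr_norm {2}/metric dotDr dotNr dotZr lerBlDr lerDl.
rewrite dotC adjK /metric linearB linearZ/= dotDr dotNr dotZr subr_ge0.
by rewrite -adjK (sqr_norm_le adjK eta_ge).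
Qed.

Lemma KadjE k : p k = Kadj (u k).
Proof. by case: k => [|k]; [case: iter|have [_ /(_ k)[]] := iter]. Qed.

(** The primal variable of the iteration seen as a three-operator splitting:
    [x k.+1] is [driver k - gamma K* u k.+1], and [xR k] is
    [driver k - gamma K* u k]. *)
Definition driver k := xR k + gamma *: p k.

Lemma x_driver k : x k.+1 = driver k - gamma *: p k.+1.
Proof.
have [_ /(_ k)[_ _ -> _]] := iter.
by rewrite /driver scalerBr opprB addrA addrAC.
Qed.

Lemma driver_step k : driver k.+1 - driver k = xR k.+1 - x k.+1.
Proof. by rewrite x_driver /driver opprB addrA addrAC. Qed.

(** The proximal step on the conjugate of [H], read off as a subgradient of
    [H] at a point which only differs from [K x^{k+1}] by a term that vanishes
    in the limit. *)
Lemma dual_subgradient k : (exists z, subdifferential H z !=set0) ->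
  subdifferential H (K (x k.+1) + gamma *: metric (u k - u k.+1)) (u k.+1).
Proof.
move=> exH; have [_ /(_ k)[uk _ _ _]] := iter.
have c0 : 0 < (gamma * eta)^-1 by rewrite invr_gt0 mulr_gt0.
have := prox_conjugate_subdifferential properH closedH convexH exH c0 uk.
rewrite invrK.
suff -> : (gamma * eta) *: (u k + (gamma * eta)^-1 *: K (xR k) - u k.+1) =
  K (x k.+1) + gamma *: metric (u k - u k.+1) by [].
have [_ /(_ k)[_ _ -> _]] := iter.
have -> : p k.+1 - p k = - Kadj (u k - u k.+1).
  by rewrite !KadjE -linearB -linearN opprB.
move: (u k.+1) => v.
rewrite scalerN opprK (linearD K) linearZ/= addrAC scalerDr scalerA.
move: (u k - v) => d.
rewrite divff ?gt_eqF ?mulr_gt0// scale1r /metric scalerBr scalerA.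
by rewrite [X in _ = _ + X]addrC addrA addrK addrC.
Qed.

Lemma primal_subgradient k : subdifferential Reg (xR k.+1)
  (gamma^-1 *: (x k.+1 - xR k.+1) - (gradF (x k.+1) + p k.+1)).
Proof.
have [_ /(_ k)[_ _ _ xk]] := iter.
have := prox_subdifferential properReg convexReg gamma_gt0 xk.
suff -> : x k.+1 - gamma *: gradF (x k.+1) - gamma *: p k.+1 - xR k.+1 =
    x k.+1 - xR k.+1 - gamma *: (gradF (x k.+1) + p k.+1).
  by rewrite scalerBr scalerA mulVf ?gt_eqF// scale1r.
by rewrite scalerDr opprD addrA [LHS]addrAC; congr (_ - _); rewrite addrAC.
Qed.

Section lyapunov.
Variables (xs : X) (us : U).
Hypothesis sol : kkt xs us.

Definition lyapunov k := `|driver k - (xs + gamma *: Kadj us)| ^+ 2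
  + gamma ^+ 2 * '[metric (u k - us), u k - us].

Lemma lyapunov_ge0 k : 0 <= lyapunov k.
Proof. by rewrite /lyapunov addr_ge0// mulr_ge0 ?sqr_ge0 ?metric_ge0. Qed.

(** The sum of the monotonicity inequalities of the two subdifferentials,
    at the new iterate and at the solution. By cocoercivity the gradient term
    left over contributes at least [2 gamma |G|^2 / LF + 2 gamma <G, d>], and
    completing the square bounds this by [- gamma LF |d|^2 / 2] from below. *)
Lemma lyapunov_decrease k :
  (1 - gamma * LF / 2) * `|xR k.+1 - x k.+1| ^+ 2
  + gamma ^+ 2 * '[metric (u k - u k.+1), u k - u k.+1]
  <= lyapunov k - lyapunov k.+1.
Proof.
have [sR sH] := sol.
have exH : exists z, subdifferential H z !=set0 by exists (K xs), us.
pose w := x k.+1 - xs; pose d := xR k.+1 - x k.+1.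
pose D := u k - u k.+1; pose e := u k.+1 - us.
pose G := gradF (x k.+1) - gradF xs; pose pi := Kadj e.
have h1 : '[G, G] <= LF * '[G, w].
  by rewrite -sqr_norm; exact: gradient_cocoercive.
have h2 : 0 <= - '[d, w + d] - gamma * '[G + pi, w + d].
  have := subdifferential_monotone properReg (primal_subgradient k) sR.
  rewrite -(pmulr_rge0 _ gamma_gt0).
  have -> : xR k.+1 - xs = w + d by rewrite [RHS]addrC addrA subrK.
  have -> : gamma^-1 *: (x k.+1 - xR k.+1) - (gradF (x k.+1) + p k.+1)
      - - (gradF xs + Kadj us) = - (gamma^-1 *: d) - (G + pi).
    rewrite opprK -addrA /d -opprB scalerN; congr (_ + _).
    by rewrite /pi /e linearB/= -KadjE [in RHS]addrACA -opprD opprB addrC.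
  rewrite (dotDl (- _)) 2!(dotNl (_ + _), dotNl (_ *: _)) dotZl.
  by rewrite mulrBr mulrN mulrA divff ?gt_eqF// mul1r.
have h3 : 0 <= '[w, pi] + gamma * '[metric D, e].
  have := subdifferential_monotone properH (dual_subgradient k exH) sH.
  by rewrite addrAC -linearB -/w -/D -/e dotC (dotDl (K w)) dotZl adjK.
have q1 : driver k.+1 - (xs + gamma *: Kadj us) = w + d + gamma *: pi.
  rewrite /driver /pi /e linearB/= -KadjE scalerBr opprD addrACA.
  by congr (_ + _); rewrite /w /d [RHS]addrC addrA subrK.
have q0 : driver k - (xs + gamma *: Kadj us) = w + gamma *: pi.
  have := driver_step k; rewrite -/d => /eqP; rewrite subr_eq => /eqP dE.
  by apply: (addIr d); rewrite [RHS]addrAC -q1 dE [LHS]addrAC [d + _]addrC.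
have ue : u k - us = D + e by rewrite /D /e addrA subrK.
rewrite /lyapunov q1 q0 ue -/D -/e -/d !sqr_norm.
clear q1 q0 ue; clearbody w d D e G pi.
have Ln0 : LF != 0 by rewrite gt_eqF.
have sq := dot_ge0 (G + (LF / 2) *: d).
have := mulr_ge0 (ltW gamma_gt0) h3.
have r0 : 0 <= 2 * gamma / LF by rewrite divr_ge0 ?ltW// mulr_gt0.
have hA : 2 * gamma / LF * '[G, G] <= 2 * gamma * '[G, w].
  have := ler_wpM2l r0 h1.
  by have -> : 2 * gamma / LF * (LF * '[G, w]) = 2 * gamma * '[G, w] by field.
have hB : 0 <= 2 * gamma / LF * '[G, G] + 2 * gamma * '[G, d]
    + gamma * LF / 2 * '[d, d].
  have := mulr_ge0 r0 sq.
  rewrite dotDl !dotDr !dotZl !dotZr (dotC d G).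
  suff -> : 2 * gamma / LF * ('[G, G] + LF / 2 * '[G, d] + (LF / 2 * '[G, d]
    + LF / 2 * (LF / 2 * '[d, d]))) = 2 * gamma / LF * '[G, G] +
    2 * gamma * '[G, d] + gamma * LF / 2 * '[d, d] by [].
  by field.
have -> : metric (D + e) = metric D + metric e.
  by have := metricB (D + e) e; rewrite addrK => ->; rewrite subrK.
move: h2 hA hB; move: (metric_sym e D).
move: (metric D) (metric e) => MD Me.
rewrite !dotE (dotC pi w) (dotC w d) (dotC pi d) => ->.
lra.
Qed.

Lemma lyapunov_nincr k : lyapunov k.+1 <= lyapunov k.
Proof.
rewrite -subr_ge0; apply: le_trans (lyapunov_decrease k).
rewrite addr_ge0// mulr_ge0 ?sqr_ge0 ?metric_ge0//.
by move: gamma_lt; rewrite ltr_pdivlMr//; lra.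
Qed.

Lemma driver_distance_le k :
  `|driver k - (xs + gamma *: Kadj us)| <= Num.sqrt (lyapunov k).
Proof.
apply: norm_le_sqrt.
by rewrite lerDl mulr_ge0 ?sqr_ge0 ?metric_ge0.
Qed.

(** The constant comes from [|gamma M v| <= sqrt eta sqrt V] and
    [|K q| <= |K| sqrt V]. *)
Definition dual_factor := (Num.sqrt eta + opnorm K) / (gamma * eta).

(** When [eta] is the square norm of [K] the metric is degenerate and the
    Lyapunov function does not bound [u k]; but the proximal step is
    nonexpansive and sees [u k] only through the metric and the driver. *)
Lemma dual_distance_le k :
  `|u k.+1 - us| <= dual_factor * Num.sqrt (lyapunov k).
Proof.
have [_ sH] := sol.
have exH : exists z, subdifferential H z !=set0 by exists (K xs), us.
have := subdifferential_monotone properH (dual_subgradient k exH) sH.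
set q := driver k - (xs + gamma *: Kadj us); set e := u k.+1 - us.
have mM : gamma * `|metric (u k - us)| <= Num.sqrt eta * Num.sqrt (lyapunov k).
  have gM : 0 <= gamma * `|metric (u k - us)| by rewrite mulr_ge0// ltW.
  rewrite -sqrtrM ?(ltW eta_gt0)// -[leLHS](ger0_norm gM) -sqrtr_sqr.
  rewrite ler_wsqrtr// exprMn.
  have := ler_wpM2l (sqr_ge0 gamma) (sqr_norm_metric_le (u k - us)).
  have := ler_wpM2l (ltW eta_gt0) (sqr_ge0 `|q|).
  by rewrite mulr0 /lyapunov -/q; lra.
have Kq : `|K q| <= opnorm K * Num.sqrt (lyapunov k).
  apply: le_trans (opnormP adjK q) _.
  by rewrite ler_wpM2l ?(opnorm_ge0 adjK)//; exact: driver_distance_le.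
have -> : K (x k.+1) + gamma *: metric (u k - u k.+1) - K xs =
    gamma *: metric (u k - us) + K q - (gamma * eta) *: e.
  have -> : x k.+1 = q + (xs - gamma *: Kadj e).
    rewrite x_driver KadjE addrA /q opprD addrA [_ + xs]addrAC subrK.
    by rewrite /e linearB scalerBr opprB addrA subrK.
  have -> : u k - u k.+1 = (u k - us) - e by rewrite opprB addrA subrK.
  clear mM Kq; move: q e (u k - us) => q e v.
  rewrite metricB (linearD K) linearB linearZ/= scalerBr -scalerA {2}/metric.
  rewrite (scalerBr _ (eta *: e)) opprB addrACA [_ - _ + (_ - _)]addrA subrK.
  by rewrite addrA [LHS]addrAC addrK [K q + _]addrC.
rewrite dotDr dotNr dotZr -sqr_norm => h.
have cs := cauchy_schwarz e (gamma *: metric (u k - us) + K q).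
have := ler_normD (gamma *: metric (u k - us)) (K q).
rewrite normrZ gtr0_norm// => tri.
rewrite /dual_factor mulrAC ler_pdivlMr ?mulr_gt0// mulrDl.
have [->|e0] := eqVneq `|e| 0.
  rewrite mul0r addr_ge0// mulr_ge0 ?sqrtr_ge0//.
  exact: opnorm_ge0 adjK.
have {e0} ne : 0 < `|e| by rewrite lt_neqAle eq_sym e0 normr_ge0.
rewrite -(ler_pM2l ne).
have := ler_wpM2l (ltW ne) (le_trans tri (lerD mM Kq)).
by move: h cs; rewrite expr2; lra.
Qed.

End lyapunov.

(** * Convergence *)

Lemma Kadj_norm_le (v : U) : `|Kadj v| <= Num.sqrt eta * `|v|.
Proof.
rewrite -[X in _ * X]ger0_norm// -sqrtr_sqr -sqrtrM ?(ltW eta_gt0)//.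
by apply: norm_le_sqrt; rewrite !sqr_norm (sqr_norm_adj_le adjK eta_ge).
Qed.

Lemma cvg_Kadj (s : nat -> U) l :
  s @ \oo --> l -> (fun n => Kadj (s n)) @ \oo --> Kadj l.
Proof. exact: (cvg_bounded_linear Kadj_norm_le). Qed.

Lemma cvg_K (s : nat -> X) l :
  s @ \oo --> l -> (fun n => K (s n)) @ \oo --> K l.
Proof. exact: (cvg_bounded_linear (opnormP adjK)). Qed.

Lemma cvg_metric (s : nat -> U) l :
  s @ \oo --> l -> (fun n => metric (s n)) @ \oo --> metric l.
Proof.
by move=> sl; apply: cvgB; [exact: cvgZl_tmp | exact/cvg_K/cvg_Kadj].
Qed.

Lemma cvg_gradF (s : nat -> X) l :
  s @ \oo --> l -> (fun n => gradF (s n)) @ \oo --> gradF l.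
Proof.
move=> sl; apply: (@cvg_dist_le _ _ _ _ (fun n => LF * `|s n - l|)) => [n|].
  by have /(_ (s n, l)) := smoothF.2; apply.
rewrite -(mulr0 LF); apply: cvgMl_tmp; rewrite -[X in _ --> X](@normr0 _ X).
by apply: cvg_norm; rewrite -(subrr l); apply: cvgB => //; exact: cvg_cst.
Qed.

Section residuals.
Variables (xs : X) (us : U).
Hypothesis sol : kkt xs us.

Let decrement k := lyapunov xs us k - lyapunov xs us k.+1.

Lemma decrement_cvg : decrement @ \oo --> 0.
Proof.
by apply: decrement_cvg0; [exact: lyapunov_ge0 | exact: lyapunov_nincr].
Qed.

Lemma primal_residual_cvg : (fun k => xR k.+1 - x k.+1) @ \oo --> 0.
Proof.
have c0 : 0 < 1 - gamma * LF / 2.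
  by move: gamma_lt; rewrite ltr_pdivlMr//; lra.
pose e k := Num.sqrt ((1 - gamma * LF / 2)^-1 * decrement k).
apply: (@cvg_dist_le _ _ _ _ e) => [k|].
  rewrite subr0; apply: norm_le_sqrt; rewrite ler_pdivlMl//.
  have := lyapunov_decrease sol k; rewrite -/(decrement k).
  have := mulr_ge0 (sqr_ge0 gamma) (metric_ge0 (u k - u k.+1)); lra.
apply: sqrtr_cvg0; rewrite -[X in _ --> X](mulr0 (1 - gamma * LF / 2)^-1).
by apply: cvgMl_tmp; exact: decrement_cvg.
Qed.

Lemma dual_residual_cvg : (fun k => metric (u k - u k.+1)) @ \oo --> 0.
Proof.
have c0 : 0 <= 1 - gamma * LF / 2.
  by move: gamma_lt; rewrite ltr_pdivlMr//; lra.
have g0 : 0 < gamma ^+ 2 by rewrite exprn_gt0.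
pose e k := Num.sqrt (eta * ((gamma ^+ 2)^-1 * decrement k)).
apply: (@cvg_dist_le _ _ _ _ e) => [k|].
  rewrite subr0; apply: norm_le_sqrt; apply: le_trans (sqr_norm_metric_le _) _.
  rewrite ler_pM2l// ler_pdivlMl//.
  have := lyapunov_decrease sol k; rewrite -/(decrement k).
  have := mulr_ge0 c0 (sqr_ge0 `|xR k.+1 - x k.+1|); lra.
apply: sqrtr_cvg0; rewrite -[X in _ --> X](mulr0 eta); apply: cvgMl_tmp.
rewrite -[X in _ --> X](mulr0 (gamma ^+ 2)^-1).
by apply: cvgMl_tmp; exact: decrement_cvg.
Qed.

Lemma lyapunov_le0 k : lyapunov xs us k <= lyapunov xs us 0%N.
Proof. by elim: k => // k; apply: le_trans; exact: lyapunov_nincr. Qed.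

Lemma driver_bounded : exists B, forall k, `|driver k| <= B.
Proof.
pose q := xs + gamma *: Kadj us.
exists (Num.sqrt (lyapunov xs us 0%N) + `|q|) => k.
rewrite -[driver k](subrK q); apply: le_trans (ler_normD _ _) _.
rewrite lerD2r; apply: le_trans (driver_distance_le xs us k) _.
by rewrite ler_wsqrtr// lyapunov_le0.
Qed.

Lemma dual_factor_ge0 : 0 <= dual_factor.
Proof.
rewrite divr_ge0 ?mulr_ge0 ?(ltW gamma_gt0) ?(ltW eta_gt0)//.
by rewrite addr_ge0 ?sqrtr_ge0 ?(opnorm_ge0 adjK).
Qed.

Lemma dual_bounded : exists B, forall k, `|u k.+1| <= B.
Proof.
exists (dual_factor * Num.sqrt (lyapunov xs us 0%N) + `|us|) => k.
rewrite -[u k.+1](subrK us); apply: le_trans (ler_normD _ _) _.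
rewrite lerD2r; apply: le_trans (dual_distance_le sol k) _.
by rewrite ler_wpM2l ?dual_factor_ge0// ler_wsqrtr// lyapunov_le0.
Qed.

Lemma lyapunov_cvg (f : nat -> nat) :
  (fun n => driver (f n)) @ \oo --> xs + gamma *: Kadj us ->
  (fun n => u (f n)) @ \oo --> us ->
  (fun n => lyapunov xs us (f n)) @ \oo --> 0.
Proof.
move=> qf uf; rewrite -[X in _ --> X]addr0; apply: cvgD.
  have nq : (fun n => `|driver (f n) - (xs + gamma *: Kadj us)|) @ \oo
      --> (0 : R).
    rewrite -[X in _ --> X](@normr0 _ X); apply: cvg_norm.
    rewrite -(subrr (xs + gamma *: Kadj us)).
    by apply: cvgB => //; exact: cvg_cst.
  rewrite -[X in _ --> X](mulr0 (0 : R)); under eq_fun do rewrite expr2.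
  exact: cvgM.
rewrite -[X in _ --> X](mulr0 (gamma ^+ 2)); apply: cvgMl_tmp.
have ue : (fun n => u (f n) - us) @ \oo --> 0.
  by rewrite -(subrr us); apply: cvgB => //; exact: cvg_cst.
rewrite -[X in _ --> X](dot0r (metric 0)).
by apply: cvg_dot => //; exact: cvg_metric.
Qed.

(** Once the Lyapunov function vanishes in the limit, everything converges to
    the point it is built on. *)
Lemma iterates_cvg : lyapunov xs us @ \oo --> 0 ->
  [/\ x @ \oo --> xs, xR @ \oo --> xs & u @ \oo --> us].
Proof.
move=> V0; have sV0 := sqrtr_cvg0 V0.
have q_cvg : driver @ \oo --> xs + gamma *: Kadj us.
  by apply: cvg_dist_le sV0 => k; exact: driver_distance_le.
have u_cvg : u @ \oo --> us.
  rewrite -(cvg_shiftS u); apply: (cvg_dist_le (dual_distance_le sol)).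
  by rewrite -(mulr0 dual_factor); exact: cvgMl_tmp.
have p_cvg : (fun k => gamma *: p k) @ \oo --> gamma *: Kadj us.
  under eq_fun do rewrite KadjE.
  by apply: cvgZl_tmp; exact: cvg_Kadj.
split=> //.
  suff : (fun k => x k.+1) @ \oo --> xs by rewrite (cvg_shiftS x).
  rewrite -[X in _ --> X](addrK (gamma *: Kadj us)).
  under eq_fun do rewrite x_driver.
  apply: cvgB => //.
  by rewrite (cvg_shiftS (fun k => gamma *: p k)).
rewrite (_ : xR = fun k => driver k - gamma *: p k); last first.
  by apply/funext => k; rewrite addrK.
by rewrite -[X in _ --> X](addrK (gamma *: Kadj us)); exact: cvgB.
Qed.

(** The residuals vanish, so a cluster point satisfies the optimality conditions
    because the graphs of both subdifferentials are closed. *)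
Lemma kkt_cluster : exists xl ul (f : nat -> nat),
  [/\ kkt xl ul, increasing_seq f,
      (fun n => driver (f n)) @ \oo --> xl + gamma *: Kadj ul &
      (fun n => u (f n)) @ \oo --> ul].
Proof.
have [B uB] := dual_bounded; have [C qC] := driver_bounded.
have [f fi /cvg_ex[ul uf]] := bounded_cvg_subseq uB.
have qfC n : `|driver (f n).+1| <= C by exact: qC.
have [g gi /cvg_ex[ql qg]] := bounded_cvg_subseq qfC.
have fg_oo := cvg_comp _ _ (cvg_increasing_seq gi) (cvg_increasing_seq fi).
have ug : (fun n => u (f (g n)).+1) @ \oo --> ul.
  exact: cvg_comp (cvg_increasing_seq gi) uf.
pose xl := ql - gamma *: Kadj ul.
have xRg : (fun n => xR (f (g n)).+1) @ \oo --> xl.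
  rewrite (_ : (fun n => _) = fun n =>
    driver (f (g n)).+1 - gamma *: Kadj (u (f (g n)).+1)); last first.
    by apply/funext => n; rewrite /driver KadjE addrK.
  by apply: cvgB => //; apply: cvgZl_tmp; exact: cvg_Kadj.
have dg : (fun n => xR (f (g n)).+1 - x (f (g n)).+1) @ \oo --> 0.
  exact: cvg_comp fg_oo primal_residual_cvg.
have xg : (fun n => x (f (g n)).+1) @ \oo --> xl.
  rewrite -[X in _ --> X]subr0 (_ : (fun n => _) = fun n =>
    xR (f (g n)).+1 - (xR (f (g n)).+1 - x (f (g n)).+1)); last first.
    by apply/funext => n; rewrite opprB addrC subrK.
  exact: cvgB.
exists xl, ul, (fun n => (f (g n)).+1); split=> //; last first.
- by rewrite /xl subrK.
- by move=> m n; exact: etrans (fi _ _) (gi _ _).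
have exH : exists z, subdifferential H z !=set0 by exists (K xs), us; case: sol.
split.
  apply: (subdifferential_closed properReg closedReg _ xRg) => [n|].
    exact: (primal_subgradient (f (g n))).
  rewrite -[X in _ --> X]add0r; apply: cvgB; last first.
    apply: cvgD; first exact: cvg_gradF.
    by under eq_fun do rewrite KadjE; exact: cvg_Kadj.
  rewrite -[X in _ --> X](scaler0 _ gamma^-1); apply: cvgZl_tmp.
  rewrite -[X in _ --> X]oppr0; under eq_fun do rewrite -opprB.
  exact: cvgN.
apply: (subdifferential_closed properH closedH _ _ ug) => [n|].
  exact: (dual_subgradient (f (g n)) exH).
rewrite -[X in _ --> X]addr0; apply: cvgD; first exact: cvg_K.
rewrite -[X in _ --> X](scaler0 _ gamma); apply: cvgZl_tmp.
exact: cvg_comp fg_oo dual_residual_cvg.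
Qed.

End residuals.

(** The given solution yields bounded iterates and vanishing residuals, hence a
    cluster point which is a solution too, and the Lyapunov function of the
    latter has a subsequence that tends to [0]. *)
Lemma iterates_cvg_kkt : (exists xs us, kkt xs us) ->
  exists xl ul,
    [/\ kkt xl ul, x @ \oo --> xl, xR @ \oo --> xl & u @ \oo --> ul].
Proof.
move=> [xs [us sol]]; have [xl [ul [f [soll fi qf uf]]]] := kkt_cluster sol.
exists xl, ul.
have [] // := iterates_cvg soll.
apply: nonincreasing_subseq_cvg0 fi _; first exact: lyapunov_ge0.
  exact: lyapunov_nincr.
exact: lyapunov_cvg.
Qed.

End iteration.

Theorem theorem2 (R : realType) (X U : finHilbertType R)
    (K : {linear X -> U}) (Kadj : {linear U -> X})
    (F : X -> R) (gradF : X -> X) (LF : R)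
    (Reg : X -> \bar R) (H : U -> \bar R)
    (gamma eta : R) (x xR p : nat -> X) (u : nat -> U)
    (adjK : is_adjoint K Kadj)
    (properReg : proper_fun Reg) (closedReg : closed_fun Reg)
    (convexReg : convex_fun Reg)
    (properH : proper_fun H) (closedH : closed_fun H) (convexH : convex_fun H)
    (convexF : convex_function setT F)
    (LF_gt0 : 0 < LF) (smoothF : is_smooth LF F gradF)
    (standing : exists xs : X,
       [set gradF xs + r + Kadj h
         | r in subdifferential Reg xs & h in subdifferential H (K xs)] 0)
    (gamma_bound : 0 < gamma < 2 / LF)
    (eta_gt0 : 0 < eta) (eta_ge : opnorm K ^+ 2 <= eta)
    (iter : PDDY gradF Reg H K Kadj (fun=> gamma) eta x xR p u) :
  (exists2 xs : X, primal_solution F Reg H K xs &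
     x @ \oo --> xs /\ xR @ \oo --> xs) /\
  (exists2 us : U, dual_solution F Reg H Kadj us & u @ \oo --> us).
Proof.
have /andP[gamma_gt0 gamma_lt] := gamma_bound.
have [xl [ul [sol xcvg xRcvg ucvg]]] :
    exists xl ul, [/\ kkt_point K Kadj gradF Reg H xl ul,
      x @ \oo --> xl, xR @ \oo --> xl & u @ \oo --> ul].
  apply: (iterates_cvg_kkt adjK properReg closedReg convexReg properH closedH
    convexH convexF LF_gt0 smoothF gamma_gt0 gamma_lt eta_gt0 eta_ge iter).
  have [xs [r sr [h sh]]] := standing => /eqP.
  rewrite addrAC addrC addr_eq0 => /eqP rE.
  by exists xs, h; split=> //; rewrite -rE.
split.
  exists xl => //.
  exact: (kkt_primal_solution adjK convexF smoothF.1 properReg properH sol).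
exists ul => //.
exact: (kkt_dual_solution adjK convexF smoothF.1 properReg properH sol).
Qed.
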